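(* Let $N=\mathbb{R}[x_1,\dots,x_n]$, let $\ast$ be a star product on $N$, and let $\odot_\nu$ be the sun product associated with $\ast$. Then: (1) $\odot_\nu$ is strongly trivial if and only if it coincides with the usual product, i.e. if and only if $F\odot_\nu G=F\cdot G$ for all $F,G\in N$. (2) If the cochains $\rho_r\colon N\to N$, $r\ge 1$, of $\odot_\nu$ are all differential operators, then $\odot_\nu$ is weakly trivial.
   Context: Let $N=\mathbb{R}[x_1,\dots,x_n]$ be the algebra of real polynomials on $\mathbb{R}^n$, with usual product denoted $\cdot$ (or by juxtaposition), and let $\nu$ be a formal parameter. **Star product on $N$.** A star product $\ast$ on $N$ is a product $F\ast G=\sum_{r\ge 0}\nu^r C_r(F,G)$ for $F,G\in N$, where $C_0(F,G)=FG$ and the $C_r\colon N\times N\to N$, $r\ge1$, are bidifferential operators. Its extension by linearity in $\nu$ is associative, and $C_1(F,G)-C_1(G,F)=2\mathcal{P}(F,G)$ for a Poisson bracket $\mathcal{P}$ on $N$. It is assumed that $F\ast G\in N[\nu]$ for $F,G\in N$, and $\ast$ is extended $\mathbb{R}[\nu]$-bilinearly to $N[\nu]$. **The map $\alpha$.** Let $\mathcal{S}$ be the symmetric tensor algebra over the vector space $N$, with $\otimes$ denoting the symmetric tensor product. The map $\alpha\colon N[\nu]\to\mathcal{S}$ is the linear map defined as follows. On monomials, $\alpha(x_1^{k_1}\cdots x_n^{k_n})=x_1^{\otimes k_1}\otimes\cdots\otimes x_n^{\otimes k_n}$, i.e. each product of coordinates is replaced by the symmetric tensor product of the coordinates, where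 each $x_i$ is regarded as a degree-one element of $\mathcal{S}$; the monomial $1$ is sent to the unit of $\mathcal{S}$. This is extended linearly to $N$, and to $N[\nu]$ by requiring that $\alpha$ annihilate all nonzero powers of $\nu$, i.e. $\alpha(\sum_r\nu^rF_r)=\alpha(F_0)$. **The evaluation map $T$.** The map $T\colon\mathcal{S}\to N[\nu]$ is the linear map with $T(1)=1$ and $$T(F_1\otimes\cdots\otimes F_k)=\frac{1}{k!}\sum_{\sigma\in S_k}F_{\sigma_1}\ast\cdots\ast F_{\sigma_k},\qquad F_1,\dots,F_k\in N,\ k\ge1,$$ where $S_k$ is the symmetric group on $\{1,\dots,k\}$. **Sun product.** The sun product associated with $\ast$ is $F\odot_\nu G=T(\alpha(F)\otimes\alpha(G))$. For $F,G\in N$ it has the form $F\odot_\nu G=\sum_{r\ge0}\nu^r\rho_r(F\cdot G)$, where $\rho_0=\mathrm{Id}$ and the $\rho_r\colon N\to N$ are linear maps, called the cochains of $\odot_\nu$. **Triviality.** In both definitions below, $S_\nu\colon N[[\nu]]\to N[[\nu]]$ is an $\mathbb{R}[[\nu]]$-linear (formally invertible) map of the form $S_\nu=\sum_{r\ge0}\nu^rS_r$ with $S_0=\mathrm{Id}$ and $S_r\colon N\to N$ a differential operator for each $r\ge1$. - $\odot_\nu$ is strongly trivial if there exists such an $S_\nu$ with $S_\nu(F\odot_\nu G)=S_\nu(F)\cdot S_\nu(G)$ for all $F,G\in N$, where $\cdot$ is the usual product extended $\mathbb{R}[[\nu]]$-bilinearly to $N[[\nu]]$. - $\odot_\nu$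 is weakly trivial if there exists such an $S_\nu$ with $S_\nu(F\cdot G)=F\odot_\nu G$ for all $F,G\in N$. *)

(* Defs.v *)
From HB Require Import structures.
From mathcomp Require Import all_boot all_order all_algebra all_fingroup.
From mathcomp Require Import finmap reals.
(* [mpoly] must come last: [monalg] reuses several of its names and notations. *)
From mathcomp Require Import ssrcomplements monalg mpoly.

Set Implicit Arguments.
Unset Strict Implicit.
Unset Printing Implicit Defensive.

Import GRing.Theory.

Local Open Scope ring_scope.

(* Here [{mpoly R[n]}] is the algebra N of polynomial functions and
   [{poly {mpoly R[n]}}] is N[nu], the indeterminate ['X] being nu. *)

Section StarProduct.
Context {R : realType} {n : nat}.
Local Notation N := {mpoly R[n]}.

Definition diff_operator (D : N -> N) : Prop :=
  exists (d : nat) (a : 'X_{1..n < d} -> N),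
    forall F, D F = \sum_(I : 'X_{1..n < d}) a I * F^`M[I].

Definition bidiff_operator (C : N -> N -> N) : Prop :=
  exists (d : nat) (a : 'X_{1..n < d} -> 'X_{1..n < d} -> N),
    forall F G, C F G =
      \sum_(I : 'X_{1..n < d}) \sum_(J : 'X_{1..n < d})
        a I J * F^`M[I] * G^`M[J].

Record poisson_bracket (P : N -> N -> N) : Prop := PoissonBracket {
  poisson_linear : forall (c : R) F G H,
    P (c *: F + G) H = c *: P F H + P G H;
  poisson_antisym : forall F G, P F G = - P G F;
  poisson_leibniz : forall F G H, P F (G * H) = P F G * H + G * P F H;
  poisson_jacobi : forall F G H,
    P F (P G H) + P G (P H F) + P H (P F G) = 0
}.

(* The cochain C_r of [star] is [fun F G => (star F G)`_r]; the codomain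
   N[nu] of [star] encodes the assumption that F * G is polynomial in nu. *)
Definition star_ext (star : N -> N -> {poly N}) (p q : {poly N}) : {poly N} :=
  \sum_(i < size p) \sum_(j < size q) star p`_i q`_j * 'X^(i + j).

Record star_product (star : N -> N -> {poly N}) : Prop := StarProduct {
  star_cochain0 : forall F G, (star F G)`_0 = F * G;
  star_bidiff : forall r, (1 <= r)%N ->
    bidiff_operator (fun F G => (star F G)`_r);
  star_assoc : associative (star_ext star);
  star_poisson : exists2 P, poisson_bracket P &
    forall F G, (star F G)`_1 - (star G F)`_1 = P F G *+ 2
}.

(* F_1 * ... * F_k, the empty product being 1. *)
Definition star_prod (star : N -> N -> {poly N}) (s : seq N) : {poly N} :=
  if s is F :: s' then foldl (fun p G => star_ext star p G%:P) F%:P s' else 1.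

Definition star_sym (star : N -> N -> {poly N}) (k : nat) (F : 'I_k -> N) :
    {poly N} :=
  (k`!%:R^-1)%:MP *: \sum_(s : 'S_k) star_prod star [seq F (s i) | i : 'I_k].

End StarProduct.

(* The symmetric algebra of the vector space N: since the monomials ['X_[m]]
   form a basis of N, it is the free commutative algebra on the set
   ['X_{1..n}] of their exponents.  Its product is the symmetric tensor
   product, and [tens1] is the inclusion of N as the degree-one part. *)
Definition symalg (R : realType) (n : nat) := {malg R[{cmonom 'X_{1..n}}]}.

HB.instance Definition _ (R : realType) (n : nat) :=
  GRing.ComAlgebra.on (symalg R n).

Section SunProduct.
Context {R : realType} {n : nat}.
Local Notation N := {mpoly R[n]}.
Local Notation SN := (symalg R n).

Definition tens1 (F : N) : SN :=
  \sum_(m <- msupp F) mkmalgU (ucm m) F@_m.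

Definition alpha (p : {poly N}) : SN :=
  \sum_(m <- msupp p`_0) (p`_0)@_m *: \prod_(i < n) tens1 'X_i ^+ m i.

(* R-linear maps SN -> N[nu]; scalars act on N[nu] through R -> N. *)
Definition symalg_linear :=
  {linear SN -> {poly N} | (@mpolyC n R) \; *:%R}.

Definition evaluation_map (star : N -> N -> {poly N}) (T : symalg_linear) :
    Prop :=
  T 1 = 1 /\
  forall (k : nat) (F : 'I_k -> N), (1 <= k)%N ->
    T (\prod_(i < k) tens1 (F i)) = star_sym star F.

Definition sun (T : SN -> {poly N}) (p q : {poly N}) : {poly N} :=
  T (alpha p * alpha q).

Definition sun_cochains (T : SN -> {poly N}) (rho : nat -> N -> N) : Prop :=
  forall (F G : N) (r : nat), (sun T F%:P G%:P)`_r = rho r (F * G).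

(* N[[nu]] and R[[nu]] are represented by sequences of coefficients, compared
   pointwise, with the Cauchy product. *)
Definition series_mul (f g : nat -> N) (k : nat) : N :=
  \sum_(i < k.+1) f i * g (k - i)%N.

Definition series_scale (c : nat -> R) (f : nat -> N) (k : nat) : N :=
  \sum_(i < k.+1) c i *: f (k - i)%N.

Definition series_of (p : {poly N}) (k : nat) : N := p`_k.

Definition series_linear (Snu : (nat -> N) -> nat -> N) : Prop :=
  (forall f g, Snu (fun k => f k + g k) =1 (fun k => Snu f k + Snu g k)) /\
  (forall c f, Snu (series_scale c f) =1 series_scale c (Snu f)).

(* Formal invertibility is automatic, since S_0 is the identity. *)
Definition formal_diff_iso (Snu : (nat -> N) -> nat -> N) : Prop :=
  series_linear Snu /\
  exists S : nat -> N -> N,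
    [/\ forall f k, Snu f k = \sum_(r < k.+1) S r (f (k - r)%N),
        S 0%N =1 id &
        forall r, (1 <= r)%N -> diff_operator (S r)].

Definition strongly_trivial (T : SN -> {poly N}) : Prop :=
  exists2 Snu, formal_diff_iso Snu &
    forall F G : N,
      Snu (series_of (sun T F%:P G%:P)) =1
      series_mul (Snu (series_of F%:P)) (Snu (series_of G%:P)).

Definition weakly_trivial (T : SN -> {poly N}) : Prop :=
  exists2 Snu, formal_diff_iso Snu &
    forall F G : N,
      Snu (series_of (F * G)%:P) =1 series_of (sun T F%:P G%:P).

End SunProduct.

Section EvaluationMap.
Context {R : realType} {n : nat}.
Local Notation N := {mpoly R[n]}.
Local Notation SN := (symalg R n).
Local Notation nuZ c p := ((c%:MP : N) *: (p : {poly N})).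
Implicit Types (F G H : N) (p q : {poly N}) (c : R).

Lemma msupp_sum_linear (V : lmodType R) (h : 'X_{1..n} -> V) :
  linear (fun F : N => \sum_(m <- msupp F) F@_m *: h m).
Proof.
have Ew d F : (msize F <= d)%N -> \sum_(m <- msupp F) F@_m *: h m =
    \sum_(m : 'X_{1..n < d}) F@_m *: h m.
  move=> le_d; rewrite (big_mksub 'X_{1..n < d}) ?msupp_uniq //=; last first.
    by move=> m /msize_mdeg_lt lt_m; apply: leq_trans le_d.
  rewrite [RHS](bigID (fun m : 'X_{1..n < d} => (m : 'X_{1..n}) \in msupp F)) /=.
  rewrite [X in _ = _ + X]big1 ?addr0 // => m /memN_msupp_eq0 ->.
  by rewrite scale0r.
move=> c F G /=; set d := maxn (msize (c *: F + G)) (maxn (msize F) (msize G)).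
rewrite !(Ew d) ?leq_max ?leqnn ?orbT // scaler_sumr -big_split /=.
by apply: eq_bigr => m _; rewrite mcoeffD mcoeffZ scalerDl scalerA.
Qed.

Lemma tens1E F : tens1 F = \sum_(m <- msupp F) F@_m *: mkmalgU (ucm m) 1 :> SN.
Proof.
apply: eq_bigr => m _; apply/malgP => k.
by rewrite monalg.mcoeffZ [in LHS]monalg.mcoeffU [X in _ * X]monalg.mcoeffU mulrnAr mulr1.
Qed.

Lemma tens1_linear : linear (@tens1 R n).
Proof. by move=> c F G; rewrite !tens1E; apply: msupp_sum_linear. Qed.

Lemma tens1X m : tens1 'X_[m] = mkmalgU (ucm m) 1 :> SN.
Proof. by rewrite /tens1 msuppX big_seq1 mcoeffX eqxx. Qed.

Lemma alphaCE F : alpha F%:P =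
  \sum_(m <- msupp F) F@_m *: \prod_(i < n) tens1 'X_i ^+ m i.
Proof. by rewrite /alpha coefC. Qed.

Lemma alphaC_linear : linear (fun F : N => alpha F%:P).
Proof. by move=> c F G; rewrite !alphaCE; apply: msupp_sum_linear. Qed.

Lemma alphaCX m : alpha ('X_[m] : N)%:P = \prod_(i < n) tens1 'X_i ^+ m i.
Proof. by rewrite alphaCE msuppX big_seq1 mcoeffX eqxx scale1r. Qed.

Lemma mpoly_lin_eq (V : zmodType) (s : R -> V -> V) (u v : N -> V) :
  (forall x, s 1 x = x) ->
  (forall c F G, u (c *: F + G) = s c (u F) + u G) ->
  (forall c F G, v (c *: F + G) = s c (v F) + v G) ->
  (forall m, u 'X_[m] = v 'X_[m]) -> u =1 v.
Proof.
move=> s1 lu lv uv F.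
have w0 w : (forall c F G, w (c *: F + G) = s c (w F) + w G) -> w (0 : N) = 0.
  move=> /(_ 1 0 0); rewrite scaler0 addr0 s1 => /eqP.
  by rewrite -{1}[w 0]addr0 (inj_eq (addrI _)) eq_sym => /eqP.
rewrite [F]mpolyE; elim: (msupp F : seq _) => [|m r IH].
  by rewrite big_nil !w0.
by rewrite big_cons lu lv uv IH.
Qed.

Lemma alphaCM F G : alpha (F * G)%:P = alpha F%:P * alpha G%:P.
Proof.
have lin := alphaC_linear.
apply: (mpoly_lin_eq (s := *:%R) (u := fun F => alpha (F * G)%:P)
  (v := fun F => alpha F%:P * alpha G%:P)) => {F} [x|c F F'|c F F'|m] /=.
- exact: scale1r.
- by rewrite mulrDl -scalerAl; apply: lin.
- by rewrite scalerAl -mulrDl; congr (_ * _); apply: lin.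
apply: (mpoly_lin_eq (s := *:%R) (u := fun G => alpha ('X_[m] * G)%:P)
  (v := fun G => alpha 'X_[m]%:P * alpha G%:P)) => {G} [x|c G G'|c G G'|m'] /=.
- exact: scale1r.
- by rewrite mulrDr -scalerAr; apply: lin.
- by rewrite scalerAr -mulrDr; congr (_ * _); apply: lin.
rewrite -mpolyXD !alphaCX -big_split /=; apply: eq_bigr => i _.
by rewrite mnmDE exprD.
Qed.

Lemma sun_cochains_exist (T : SN -> {poly N}) : exists rho, sun_cochains T rho.
Proof.
by exists (fun r F => (T (alpha F%:P))`_r) => F G r; rewrite alphaCM.
Qed.

Section Star.
Context (star : N -> N -> {poly N}) (star_ax : star_product star).

Lemma star_linearl c F G H :
  star (c *: F + G) H = nuZ c (star F H) + star G H.
Proof.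
apply/polyP => r; rewrite coefD coefZ.
case: r => [|r].
  by rewrite !(star_cochain0 star_ax) mulrDl -scalerAl mul_mpolyC.
have [d [a E]] := @star_bidiff _ _ _ star_ax r.+1 isT.
rewrite !E mulr_sumr -big_split; apply: eq_bigr => I _ /=.
rewrite mulr_sumr -big_split; apply: eq_bigr => J _ /=.
by rewrite mderivmD mderivmZ mulrDr mulrDl mul_mpolyC -scalerAr -scalerAl.
Qed.

Lemma star_linearr c F G H :
  star H (c *: F + G) = nuZ c (star H F) + star H G.
Proof.
apply/polyP => r; rewrite coefD coefZ.
case: r => [|r].
  by rewrite !(star_cochain0 star_ax) mulrDr -scalerAr mul_mpolyC.
have [d [a E]] := @star_bidiff _ _ _ star_ax r.+1 isT.
rewrite !E mulr_sumr -big_split; apply: eq_bigr => I _ /=.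
rewrite mulr_sumr -big_split; apply: eq_bigr => J _ /=.
by rewrite mderivmD mderivmZ mulrDr mul_mpolyC -scalerAr.
Qed.

Lemma star0l H : star 0 H = 0.
Proof.
have /eqP := star_linearl 1 0 0 H; rewrite scaler0 addr0 scale1r.
by rewrite -{1}[star 0 H]addr0 (inj_eq (addrI _)) eq_sym => /eqP.
Qed.

Lemma star0r H : star H 0 = 0.
Proof.
have /eqP := star_linearr 1 0 0 H; rewrite scaler0 addr0 scale1r.
by rewrite -{1}[star H 0]addr0 (inj_eq (addrI _)) eq_sym => /eqP.
Qed.

Lemma star_extEw a b p q : (size p <= a)%N -> (size q <= b)%N ->
  star_ext star p q = \sum_(i < a) \sum_(j < b) star p`_i q`_j * 'X^(i + j).
Proof.
move=> le_a le_b; rewrite /star_ext.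
rewrite (big_ord_widen _ (fun i => \sum_(j < size q) star p`_i q`_j * 'X^(i + j)) le_a).
rewrite big_mkcond; apply: eq_bigr => i _ /=.
rewrite (big_ord_widen _ (fun j => star p`_i q`_j * 'X^(i + j)) le_b) big_mkcond /=.
case: ltnP => [_|ge_i].
  apply: eq_bigr => j _; case: ltnP => // ge_j.
  by rewrite [q`_j]nth_default // star0r mul0r.
by rewrite big1 // => j _; rewrite [p`_i]nth_default // star0l mul0r.
Qed.

Lemma star_ext_linearl c p p' q :
  star_ext star (nuZ c p + p') q =
  nuZ c (star_ext star p q) + star_ext star p' q.
Proof.
set a := maxn (size (nuZ c p + p')) (maxn (size p) (size p')).
rewrite !(@star_extEw a (size q)) ?leq_max ?leqnn ?orbT //.
rewrite scaler_sumr -big_split; apply: eq_bigr => i _ /=.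
rewrite scaler_sumr -big_split; apply: eq_bigr => j _ /=.
by rewrite coefD coefZ mul_mpolyC star_linearl mulrDl -scalerAl.
Qed.

Lemma star_ext_linearr c p q q' :
  star_ext star p (nuZ c q + q') =
  nuZ c (star_ext star p q) + star_ext star p q'.
Proof.
set b := maxn (size (nuZ c q + q')) (maxn (size q) (size q')).
rewrite !(@star_extEw (size p) b) ?leq_max ?leqnn ?orbT //.
rewrite scaler_sumr -big_split; apply: eq_bigr => i _ /=.
rewrite scaler_sumr -big_split; apply: eq_bigr => j _ /=.
by rewrite coefD coefZ mul_mpolyC star_linearr mulrDl -scalerAl.
Qed.

Lemma star_prod_linear c F G s1 s2 :
  star_prod star (s1 ++ (c *: F + G) :: s2) =
  nuZ c (star_prod star (s1 ++ F :: s2)) + star_prod star (s1 ++ G :: s2).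
Proof.
have polyC_lin : (c *: F + G)%:P = nuZ c F%:P + G%:P :> {poly N}.
  by rewrite polyCD -mul_polyC -polyCM mul_mpolyC.
have foldl_lin p q s :
    foldl (fun p G => star_ext star p G%:P) (nuZ c p + q) s =
    nuZ c (foldl (fun p G => star_ext star p G%:P) p s) +
    foldl (fun p G => star_ext star p G%:P) q s.
  by elim: s p q => //= H s IH p q; rewrite star_ext_linearl IH.
case: s1 => [|H s1] /=; first by rewrite polyC_lin foldl_lin.
by rewrite !foldl_cat /= polyC_lin star_ext_linearr foldl_lin.
Qed.

Definition update_at k (F : 'I_k -> N) i G j := if j == i then G else F j.

Lemma star_sym_linear k (F : 'I_k -> N) i c G H :
  star_sym star (update_at F i (c *: G + H)) =
  nuZ c (star_sym star (update_at F i G)) + star_sym star (update_at F i H).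
Proof.
rewrite /star_sym scalerA [_%:MP * _]mulrC -scalerA -scalerDr.
congr (_ *: _); rewrite scaler_sumr -big_split; apply: eq_bigr => s _ /=.
rewrite /image_mem; set j := (s^-1)%g i.
have E K e : j \notin e ->
    [seq update_at F i K (s x) | x <- e] = [seq F (s x) | x <- e].
  move=> j_e; apply/eq_in_map => x x_e; rewrite /update_at.
  case: eqP => // sx; case/negP: j_e.
  by rewrite /j -sx permK.
have := enum_uniq 'I_k; have : j \in enum 'I_k by rewrite mem_enum.
case/splitPr => e1 e2; rewrite cat_uniq /= negb_or.
case/and3P=> _ /andP[j1 _] /andP[j2 _].
by rewrite !map_cat /= !E // /update_at !permKV eqxx star_prod_linear.
Qed.

Lemma eq_star_sym k (F G : 'I_k -> N) : F =1 G -> star_sym star F = star_sym star G.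
Proof.
move=> FG; congr (_ *: _); apply: eq_bigr => s _; congr star_prod.
by apply: eq_map => i; rewrite FG.
Qed.

Lemma star_sym_perm k l (F : 'I_k -> N) (G : 'I_l -> N) :
  perm_eq (codom F) (codom G) -> star_sym star F = star_sym star G.
Proof.
move=> pFG; have kl : k = l.
  by move/perm_size: (pFG); rewrite !size_codom !card_ord.
case: l / kl G pFG => G.
have E (K : 'I_k -> N) : codom K = [tuple K i | i < k].
  by rewrite codomE.
rewrite !E => /tuple_permP[t /= Et].
have {}Et i : F i = G (t i).
  have := congr1 (fun s => nth 0 s i) Et.
  rewrite !(nth_map i) -?enumT ?size_enum_ord // !nth_ord_enum.
  by rewrite tnth_mktuple.
rewrite (eq_star_sym Et); congr (_ *: _).
rewrite [RHS](reindex_inj (mulIg t)) /=; apply: eq_bigr => s _.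
by congr star_prod; apply: eq_map => i; rewrite permM.
Qed.

Definition cmonom_seq (m : {cmonom 'X_{1..n}}) : seq 'X_{1..n} :=
  flatten [seq nseq (m x) x | x <- finsupp m].

Lemma count_cmonom_seq m y : count_mem y (cmonom_seq m) = m y.
Proof.
rewrite /cmonom_seq count_flatten -map_comp sumnE big_map.
under eq_bigr => x _ do rewrite /= count_nseq /=.
case: (boolP (y \in finsupp m)) => [y_m|y_m].
  rewrite (big_rem y) //= eqxx mul1n big_seq big1 ?addn0 // => x.
  by rewrite mem_rem_uniq ?fset_uniq // !inE => /andP[/negPf-> _].
rewrite big_seq big1 => [|x x_m].
  by apply/esym/eqP; rewrite cmE_eq0.
by case: eqP => [xy|//]; rewrite xy (negPf y_m) in x_m.
Qed.

Definition eval_basis (m : {cmonom 'X_{1..n}}) : {poly N} :=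
  star_sym star (fun i : 'I_(size (cmonom_seq m)) =>
    'X_[nth 0%MM (cmonom_seq m) i]).

Definition eval_fun : SN -> {poly N} :=
  monalg.mmap (polyC \o @mpolyC n R) eval_basis.

Lemma eval_fun_linear : linear_for ((@mpolyC n R) \; *:%R) eval_fun.
Proof.
move=> c x y; rewrite /eval_fun monalg.mmapD; congr (_ + _).
rewrite /= (monalg.mmapEw (monalg.msuppZ_le _ _)) monalg.mmapE scaler_sumr.
apply: eq_bigr => m _.
by rewrite monalg.mcoeffZ /= mpolyCM polyCM -mulrA mul_polyC.
Qed.

Theorem evaluation_map_exists : exists T : symalg_linear, evaluation_map star T.
Proof.
pose T0 : symalg_linear := HB.pack_for symalg_linear eval_fun
  (GRing.isLinear.Build R SN {poly N} ((@mpolyC n R) \; *:%R) eval_fun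
     eval_fun_linear).
have [T TE] : exists T : symalg_linear, T =1 eval_fun by exists T0.
clear T0.
have mkmalgU_M (a b : {cmonom 'X_{1..n}}) :
    mkmalgU (mmul a b) 1 = mkmalgU a 1 * mkmalgU b 1 :> SN.
  by rewrite [RHS]fgmulUU mulr1.
have T_lin c x y : T (c *: x + y) = nuZ c (T x) + T y 
  by rewrite !TE; apply: eval_fun_linear.
have T_basis m : T (mkmalgU m 1) = eval_basis m.
  by rewrite TE /eval_fun monalg.mmapU /= mpolyC1 polyC1 mul1r.
exists T; split=> [|k F _].
  have -> : (1 : SN) = mkmalgU mone 1 by [].
  rewrite T_basis /eval_basis.
  have -> : cmonom_seq mone = [::].
    by rewrite /cmonom_seq mdom1.
  rewrite /star_sym /= fact0 invr1 mpolyC1 scale1r.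
  rewrite (eq_bigr (fun=> 1)) => [|s _]; last first.
    by rewrite /image_mem (size0nil (etrans (size_enum_ord 0) (erefl _))).
  by rewrite sumr_const card_Sn fact0.
suff H r (G : 'I_k -> N) :
    (forall i : 'I_k, (r <= i)%N -> exists m, G i = 'X_[m]) ->
    T (\prod_(i < k) tens1 (G i)) = star_sym star G.
  by apply: (H k) => i; rewrite leqNgt ltn_ord.
elim: r G => [|r IH] G G_mon.
  have {}G_mon i : exists m, G i == 'X_[m].
    by have [m ->] := G_mon i isT; exists m.
  pose e i := xchoose (G_mon i).
  have Ge i : G i = 'X_[e i] by apply/eqP/(xchooseP (G_mon i)).
  under eq_bigr => i _ do rewrite Ge tens1X.
  pose M := \big[mmul/mone]_(i < k) ucm (e i).
  have -> : \prod_(i < k) (mkmalgU (ucm (e i)) 1 : SN) = mkmalgU M 1.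
    rewrite (big_morph (fun m => mkmalgU m 1 : SN) mkmalgU_M (erefl _)) //.
  rewrite T_basis; apply: star_sym_perm.
  have -> : codom (fun i : 'I_(size (cmonom_seq M)) =>
      'X_[nth 0%MM (cmonom_seq M) i] : N) = [seq 'X_[m] | m <- cmonom_seq M].
    rewrite codomE (map_comp (fun i => 'X_[nth 0%MM (cmonom_seq M) i]) val).
    rewrite val_enum_ord (map_comp (fun m => 'X_[m])).
    by congr map; apply: mkseq_nth.
  have -> : codom G = [seq 'X_[m] | m <- codom e].
    exact: etrans (eq_map Ge _) (map_comp (fun m => 'X_[m]) e _).
  apply: perm_map; apply/allP => y _ /=; rewrite count_cmonom_seq.
  rewrite (big_morph (fun m : {cmonom _} => m y) (cmM y) (cm1 y)).
  rewrite -sum1_count big_image_cond /=.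
  apply/eqP; rewrite [RHS]big_mkcond /=; apply: eq_bigr => i _.
  by rewrite cmU; case: eqP.
case: (ltnP r k) => [lt_rk|le_kr]; last first.
  by apply: IH => i /(leq_trans le_kr); rewrite leqNgt ltn_ord.
pose i0 := Ordinal lt_rk.
have updE : update_at G i0 (G i0) =1 G by move=> j; rewrite /update_at; case: eqP => [->|].
have prodE K : \prod_(i < k) tens1 (update_at G i0 K i) =
    tens1 K * \prod_(i < k | i != i0) tens1 (G i).
  have E (f : 'I_k -> SN) : \prod_(i < k) f i =
      f i0 * \prod_(i < k | i != i0) f i by rewrite (bigD1 i0).
  have upd0 : update_at G i0 K i0 = K by rewrite /update_at eqxx.
  have updN (i : 'I_k) : i != i0 -> tens1 (update_at G i0 K i) = tens1 (G i) :> SN.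
    by move=> /negPf ne_i; rewrite /update_at ne_i.
  apply: etrans (E _) _.
  refine (f_equal2 _ (congr1 tens1 upd0) _).
  exact: (eq_bigr _ updN).
rewrite -(eq_star_sym updE) -(eq_bigr _ (fun i _ => congr1 tens1 (updE i))).
move: (G i0); apply: (mpoly_lin_eq (s := fun c p => nuZ c p)) => [x|c x y|c x y|m].
- by rewrite mpolyC1 scale1r.
- rewrite -T_lin; apply: (congr1 T); apply: etrans (prodE _) _.
  rewrite tens1_linear mulrDl -scalerAl; apply: esym.
  exact: (f_equal2 _ (congr1 _ (prodE _)) (prodE _)).
- exact: star_sym_linear.
apply: IH => i; rewrite leq_eqVlt => /orP[/eqP ri|lt_ri].
  by exists m; rewrite /update_at [i == i0](introT eqP) //; apply: val_inj.
have [m' Gm'] := G_mon i lt_ri.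
by exists m'; rewrite /update_at ifN //; apply/eqP => ii0; rewrite ii0 /= ltnn in lt_ri.
Qed.

Theorem evaluation_map_unique (T T' : symalg_linear) :
  evaluation_map star T -> evaluation_map star T' -> T =1 T'.
Proof.
move=> [T1 TF] [T'1 T'F].
have basisE m : mkmalgU m 1 = \prod_(i < size (cmonom_seq m))
    tens1 'X_[nth 0%MM (cmonom_seq m) i] :> SN.
  under eq_bigr => i _ do rewrite tens1X.
  have mkmalgU_M (a b : {cmonom 'X_{1..n}}) :
      mkmalgU (mmul a b) 1 = mkmalgU a 1 * mkmalgU b 1 :> SN.
    by rewrite [RHS]fgmulUU mulr1.
  rewrite -(big_morph (fun m => mkmalgU m 1 : SN) mkmalgU_M (erefl _)).
  apply: (congr1 (fun m => mkmalgU m 1)); apply/eqP/cmP => y.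
  rewrite (big_morph (fun m : {cmonom _} => m y) (cmM y) (cm1 y)).
  rewrite -count_cmonom_seq -sum1_count (big_nth 0%MM) big_mkord big_mkcond /=.
  by apply: eq_bigr => i _; rewrite cmU; case: eqP.
have TT' m : T (mkmalgU m 1) = T' (mkmalgU m 1).
  rewrite basisE; case: (posnP (size (cmonom_seq m))) => [s0|s_gt0].
    by rewrite big1 ?T1 ?T'1 // => i _; case: i => i; rewrite s0.
  by rewrite TF // T'F.
move=> s; rewrite [s]monalgE !linear_sum; apply: eq_bigr => m _.
have -> : mkmalgU m (monalg.mcoeff m s) = monalg.mcoeff m s *: mkmalgU m 1 :> SN.
  apply/malgP => x; rewrite monalg.mcoeffZ [in LHS]monalg.mcoeffU.
  by rewrite [X in _ * X]monalg.mcoeffU mulrnAr mulr1.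
by rewrite !linearZ /= TT'.
Qed.

End Star.
End EvaluationMap.

(* Main.v *)
Require Import Defs.
From mathcomp Require Import all_boot all_order all_algebra all_fingroup.
From mathcomp Require Import reals mpoly.

(** Since [alpha] is multiplicative, [sun T F G = rho (F * G)] with
    [rho F = T (alpha F) = F + O(nu)] and [rho 1 = 1].  For (2), [rho] itself
    is the required equivalence.  For (1), strong triviality reads
    [S (rho (F * G)) = S F * S G].  At [F = G = 1] the invertible series [S 1]
    is idempotent, so [S 1 = 1]; at [G = 1] this leaves [S (rho F) = S F],
    and [S], being injective, forces [rho F = F]. *)

Local Open Scope ring_scope.
Import GRing.Theory.

Section Series.
Context {R : realType} {n : nat}.
Local Notation N := {mpoly R[n]}.

(** By strong induction the inner terms of the Cauchy product vanish. Its two end terms leave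
    [u k = u k + u k]. *)
Lemma series_idem_eq0 (u : nat -> N) :
  u 0%N = 1 -> u =1 series_mul u u -> forall k, (0 < k)%N -> u k = 0.
Proof.
move=> u0 uu k; have [m] := ubnP k; elim: m k => // m IH [//|k] lt_km _.
have : u k.+1 = u k.+1 + u k.+1.
  rewrite {1}uu /series_mul big_ord_recl big_ord_recr /= /bump leq0n add1n.
  rewrite subnn subn0 u0 mul1r mulr1 big1 ?add0r // => i _.
  by rewrite /bump leq0n add1n IH ?mul0r // -ltnS (leq_trans _ lt_km) // !ltnS.
by move/eqP; rewrite -{1}[u k.+1]addr0 (inj_eq (addrI _)) eq_sym => /eqP.
Qed.

Lemma series_mulr1 (f u : nat -> N) :
  u 0%N = 1 -> (forall k, (0 < k)%N -> u k = 0) -> series_mul f u =1 f.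
Proof.
move=> u0 uS k; rewrite /series_mul big_ord_recr /= subnn u0 mulr1.
by rewrite big1 ?add0r // => i _; rewrite uS ?mulr0 // subn_gt0.
Qed.

Lemma series_of_polyC (F : N) k :
  series_of F%:P k = if k == 0%N then F else 0.
Proof. exact: coefC. Qed.

Lemma series_mul_polyC (F G : N) :
  series_mul (series_of F%:P) (series_of G%:P) =1 series_of (F * G)%:P.
Proof.
move=> k; rewrite /series_mul big_ord_recl subn0.
rewrite [X in _ + X]big1 => [|i _]; last by rewrite series_of_polyC mul0r.
rewrite addr0 !series_of_polyC /=.
by case: k => [|k] //=; rewrite mulr0.
Qed.

Lemma formal_diff_iso0 {Snu : (nat -> N) -> nat -> N} :
  formal_diff_iso Snu -> forall f, Snu f 0%N = f 0%N.
Proof. by case=> _ [S [SE S0 _]] f; rewrite SE big_ord1 S0 subnn. Qed.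

(** [Snu] is unitriangular: its coefficient in degree [k] is [f k] plus terms in lower coefficients
    of [f], which agree by induction and cancel. *)
Lemma formal_diff_iso_inj {Snu : (nat -> N) -> nat -> N} :
  formal_diff_iso Snu -> forall f g, Snu f =1 Snu g -> f =1 g.
Proof.
case=> _ [S [SE S0 _]] f g fg k; have [m] := ubnP k.
elim: m k => // m IH k lt_km; have := fg k.
rewrite !SE !big_ord_recl /= !S0 !subn0.
rewrite (eq_bigr (fun i : 'I_k => S (bump 0 i) (g (k - bump 0 i)%N))).
  exact: addIr.
move=> i _; congr (S _ _); apply: IH; rewrite /bump leq0n add1n.
by rewrite -ltnS (leq_trans _ lt_km) // !ltnS ltn_subrL (leq_trans _ (ltn_ord i)).
Qed.

Lemma diff_operator0 : diff_operator (fun _ : N => 0).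
Proof.
exists 0%N, (fun=> 0) => F.
by rewrite big1 // => I _; rewrite mul0r.
Qed.

(** Both sides run over the pairs with [r + i <= k]. Padding with zeros to a full square makes the
    order of summation exchangeable. *)
Lemma sum_triangle (g : nat -> nat -> N) k :
  \sum_(r < k.+1) \sum_(i < (k - r).+1) g r i =
  \sum_(i < k.+1) \sum_(r < (k - i).+1) g r i.
Proof.
have widen (h : nat -> N) (r : 'I_k.+1) : \sum_(i < (k - r).+1) h i =
    \sum_(i < k.+1) if (r + i <= k)%N then h i else 0.
  rewrite (big_ord_widen k.+1) ?ltnS ?leq_subr // big_mkcond.
  by apply: eq_bigr => i _; rewrite ltnS leq_subRL // -ltnS.
under eq_bigr => r _ do rewrite widen.
under [RHS]eq_bigr => i _ do rewrite (widen (g^~ i)).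
by rewrite exchange_big; do 2!apply: eq_bigr => ? _; rewrite addnC.
Qed.

(** Convolution with the [S r] commutes with convolution by scalars: both orders sum
    [c i *: S r (f (k - r - i))] over the same triangle. *)
Lemma series_linear_conv (S : nat -> N -> N) :
  (forall r c F G, S r (c *: F + G) = c *: S r F + S r G) ->
  series_linear (fun f k => \sum_(r < k.+1) S r (f (k - r)%N)).
Proof.
move=> S_lin.
have SD r F G : S r (F + G) = S r F + S r G.
  by rewrite -[F]scale1r S_lin !scale1r.
have S0 r : S r 0 = 0.
  by apply: (@addrI _ (S r 0)); rewrite -SD !addr0.
have SZ r c F : S r (c *: F) = c *: S r F.
  by rewrite -[c *: F]addr0 S_lin S0 addr0.
split=> [f g k|c f k].
  by rewrite -big_split; apply: eq_bigr => r _; rewrite SD.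
have S_sum r K (F : nat -> N) : S r (\sum_(i < K) F i) = \sum_(i < K) S r (F i).
  exact: (big_morph (S r) (SD r) (S0 r)).
rewrite (eq_bigr (fun r : 'I_k.+1 =>
  \sum_(i < (k - r).+1) S r (c i *: f (k - r - i)%N))) => [|r _].
  rewrite (sum_triangle (fun r i => S r (c i *: f (k - r - i)%N))).
  apply: eq_bigr => i _; rewrite scaler_sumr.
  by apply: eq_bigr => r _; rewrite SZ subnAC.
exact: (S_sum r (k - r).+1 (fun i => c i *: f (k - r - i)%N)).
Qed.

End Series.

Section Sun.
Context {R : realType} {n : nat}.
Local Notation N := {mpoly R[n]}.
Context {star : N -> N -> {poly N}} (hstar : star_product star).
Context {T : @symalg_linear R n} (hT : evaluation_map star T).

Lemma coef0_star_ext (p q : {poly N}) : (star_ext star p q)`_0 = p`_0 * q`_0.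
Proof.
(* The bounds are raised by one so that the index 0 exists even when [p] or [q] is zero; every other
   index carries a positive power of ['X]. *)
rewrite (@star_extEw _ _ _ hstar (size p).+1 (size q).+1) // coef_sum.
rewrite big_ord_recl [X in _ + X]big1 ?addr0 => [|i _]; last first.
  by rewrite coef_sum big1 // => j _; rewrite coefMXn.
rewrite coef_sum big_ord_recl [X in _ + X]big1 ?addr0 => [|j _]; last by rewrite coefMXn.
by rewrite coefMXn /= (star_cochain0 hstar).
Qed.

Lemma coef0_star_prod (s : seq N) : (star_prod star s)`_0 = \prod_(F <- s) F.
Proof.
case: s => [|F s] /=; first by rewrite big_nil coef1.
(* Writing [F] as a coefficient of [F%:P] lets the induction generalize over the accumulator of
   [foldl]. *)
rewrite big_cons -[F in RHS](coefC F 0).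
elim: s (F%:P) => [|G s IH] p /=; first by rewrite big_nil mulr1.
by rewrite IH coef0_star_ext coefC big_cons mulrA.
Qed.

Lemma coef0_star_sym k (F : 'I_k -> N) :
  (star_sym star F)`_0 = \prod_(i < k) F i.
Proof.
rewrite /star_sym coefZ coef_sum.
rewrite (eq_bigr (fun=> \prod_(i < k) F i)) => [|s _]; last first.
  rewrite coef0_star_prod big_image /=.
  by rewrite [RHS](reindex_inj (@perm_inj _ s)).
rewrite sumr_const card_Sn mul_mpolyC -[X in _ *: X]scaler_nat scalerA.
rewrite mulVf ?scale1r //.
by rewrite Num.Theory.pnatr_eq0 -lt0n fact_gt0.
Qed.

Lemma coef0_evaluation_map (s : seq N) :
  (T (\prod_(F <- s) tens1 F))`_0 = \prod_(F <- s) F.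
Proof.
have [T1 TF] := hT; case: (posnP (size s)) => [/size0nil ->|s_gt0].
  by rewrite !big_nil T1 coef1.
have nthE (A : comPzRingType) (f : N -> A) :
    \prod_(F <- s) f F = \prod_(i < size s) f s`_i.
  by rewrite (big_nth 0) big_mkord.
rewrite [RHS](nthE _ id) -coef0_star_sym -TF //.
by apply: (congr1 (fun x => (T x)`_0)); apply: nthE.
Qed.

Definition sun_map (F : N) : {poly N} := T (alpha F%:P).

Lemma sunE (F G : N) : sun T F%:P G%:P = sun_map (F * G).
Proof. by rewrite /sun /sun_map alphaCM. Qed.

Lemma sun_map_linear c (F G : N) :
  sun_map (c *: F + G) = c%:MP *: sun_map F + sun_map G.
Proof. by rewrite /sun_map alphaC_linear linearP. Qed.

Lemma sun_map1 : sun_map 1 = 1.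
Proof.
rewrite /sun_map -mpolyX0 alphaCX big1; first by case: hT.
by move=> i _; rewrite mnm0E.
Qed.

(** By linearity monomials suffice; there [alpha] splits into coordinates and [T] multiplies them
    back modulo nu. *)
Lemma coef0_sun_map F : (sun_map F)`_0 = F.
Proof.
apply: (mpoly_lin_eq (s := *:%R) (u := fun F => (sun_map F)`_0)
  (v := id)) => {F} [x|c F G|//|m].
- exact: scale1r.
- by rewrite sun_map_linear coefD coefZ mul_mpolyC.
(* The coordinates of ['X_[m]] listed with multiplicity. [prodE] is stated for any [f] to serve both
   [tens1] and the identity. *)
pose s : seq N := flatten [seq nseq (m i) 'X_i | i <- enum 'I_n].
have prodE (A : comPzRingType) (f : N -> A) :
    \prod_(i < n) f 'X_i ^+ m i = \prod_(F <- s) f F.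
  rewrite big_flatten big_map big_enum /=.
  apply: eq_bigr => i _; rewrite big_nseq.
  by elim: (m i) => //= d <-; rewrite exprS.
by rewrite /sun_map alphaCX prodE coef0_evaluation_map -(prodE _ id) -mpolyXE_id.
Qed.

End Sun.

Theorem proposition3 (R : realType) (n : nat)
    (star : {mpoly R[n]} -> {mpoly R[n]} -> {poly {mpoly R[n]}})
    (hstar : star_product star)
    (T : @symalg_linear R n) (hT : evaluation_map star T) :
  (strongly_trivial T <->
     forall F G : {mpoly R[n]}, sun T F%:P G%:P = (F * G)%:P) /\
  (forall rho : nat -> {mpoly R[n]} -> {mpoly R[n]},
     sun_cochains T rho ->
     (forall r : nat, (1 <= r)%N -> diff_operator (rho r)) ->
     weakly_trivial T).
Proof.
split; [split|].
- case=> Snu isoS trivS F G; rewrite sunE.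
  set u := Snu (series_of 1%:P).
  have u0 : u 0%N = 1 by rewrite /u (formal_diff_iso0 isoS) series_of_polyC.
  have uS k : (0 < k)%N -> u k = 0.
    apply: series_idem_eq0 => // {}k.
    by rewrite -trivS sunE mulr1 (sun_map1 hT).
  apply/polyP => k; apply: (formal_diff_iso_inj isoS) k => k.
  have := trivS (F * G) 1 k; rewrite sunE mulr1 => ->.
  exact: series_mulr1.
(* Conversely the identity works, with [S 0 = id] and all higher [S r] zero. *)
- move=> sunM; exists id => [|F G k]; last first.
    by rewrite sunM -series_mul_polyC.
  split; first by split.
  exists (fun r F => if r is 0%N then F else 0); split=> // [f k|[//|r] _].
    by rewrite big_ord_recl subn0 big1 ?addr0.
  exact: diff_operator0.
move=> rho rhoP rho_diff.
(* Pairing [F] with 1 identifies [rho r], which thus inherits linearity from [T] and [alpha]. *)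
have rhoE r F : rho r F = (sun_map (T := T) F)`_r.
  by rewrite -[F]mulr1 -rhoP sunE.
have rho_lin r c F G : rho r (c *: F + G) = c *: rho r F + rho r G.
  by rewrite !rhoE sun_map_linear coefD coefZ mul_mpolyC.
have rho0 r : rho r 0 = 0.
  by have := rho_lin r (-1) 0 0; rewrite scaleN1r oppr0 addr0 scaleN1r addNr.
exists (fun f k => \sum_(r < k.+1) rho r (f (k - r)%N)) => [|F G k].
  split; first exact: series_linear_conv.
  exists rho; split=> // F; rewrite rhoE.
  exact: (coef0_sun_map hstar hT).
(* On a constant series only the summand [r = k] survives. *)
rewrite big_ord_recr /= subnn series_of_polyC big1 ?add0r -?rhoP // => i _.
by rewrite series_of_polyC subn_eq0 leqNgt ltn_ord rho0.
Qed.
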